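(* Let $q$ be a prime power, $1 \le t \le k \le n$ and $\lambda, s \ge 1$ integers. If there exist $s$ pairwise disjoint $t$-$(n,k,\lambda)$ designs over $\mathbb{F}_q$, then for each $1 \le j \le s$, $$\mathcal{A}_q(n,k,t;\lambda j) = \lambda j \cdot \binom{n}{t}_q \Big/ \binom{k}{t}_q.$$
   Context: $\binom{a}{b}_q$ denotes the Gaussian binomial coefficient, the number of $b$-dimensional subspaces of $\mathbb{F}_q^a$. A $t$-$(n,k,\lambda)$ design over $\mathbb{F}_q$ is a set of $k$-dimensional subspaces (blocks) of $\mathbb{F}_q^n$ such that every $t$-dimensional subspace of $\mathbb{F}_q^n$ is contained in exactly $\lambda$ blocks; designs are pairwise disjoint if no two share a block. A $t$-$(n,k,\lambda)_q$ subspace packing is a collection of $k$-dimensional subspaces (blocks) of $\mathbb{F}_q^n$ such that every $t$-dimensional subspace is contained in at most $\lambda$ blocks; $\mathcal{A}_q(n,k,t;\lambda)$ denotes the maximum number of blocks of such a packing without repeated blocks. *)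

(* Defs.v *)
From HB Require Import structures.
From mathcomp Require Export all_boot all_order all_algebra.

Set Implicit Arguments.
Unset Strict Implicit.
Unset Printing Implicit Defensive.

Import Order.TTheory GRing.Theory Num.Theory.

(* MathComp only makes [{vspace vT}] a choiceType; over a finite field it is a
   subtype of a finite type of matrices. *)
Section VspaceFinite.
Import VectorInternalTheory.
Variables (F : finFieldType) (vT : vectType F).
HB.instance Definition _ := [Countable of {vspace vT} by <:].
HB.instance Definition _ := [Finite of {vspace vT} by <:].
End VspaceFinite.

(* Below, [F] is a field with q elements and F_q^n is ['rV[F]_n]. *)

Definition gauss_binom (F : finFieldType) (a b : nat) : nat :=
  #|[set U : {vspace 'rV[F]_a} | \dim U == b]|.

Definition containing (F : finFieldType) (n : nat)
    (B : {set {vspace 'rV[F]_n}}) (T : {vspace 'rV[F]_n}) :=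
  [set U in B | (T <= U)%VS].

Definition subspace_design (F : finFieldType) (t n k lam : nat)
    (B : {set {vspace 'rV[F]_n}}) : bool :=
  [forall U in B, \dim U == k] &&
  [forall T : {vspace 'rV[F]_n}, (\dim T == t) ==> (#|containing B T| == lam)].

(* A packing is represented by a set, hence has no repeated blocks. *)
Definition subspace_packing (F : finFieldType) (t n k lam : nat)
    (B : {set {vspace 'rV[F]_n}}) : bool :=
  [forall U in B, \dim U == k] &&
  [forall T : {vspace 'rV[F]_n}, (\dim T == t) ==> (#|containing B T| <= lam)].

(* The maximum is over a nonempty family: [set0] is always a packing. *)
Definition max_packing (F : finFieldType) (n k t lam : nat) : nat :=
  \max_(B : {set {vspace 'rV[F]_n}} | subspace_packing t k lam B) #|B|.

(* Main.v *)
(** Counting pairs (T, U) with T a t-subspace of a block U in two ways gives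
    [|B| * binom(k, t) = sum_T #{blocks through T}]: every packing satisfies the
    upper bound, with equality for a design, and the union of j of the disjoint
    designs is a design with index [lam * j]. *)
From HB Require Import structures.
Require Import Defs.

Set Implicit Arguments.
Unset Strict Implicit.
Unset Printing Implicit Defensive.

Import Order.TTheory GRing.Theory Num.Theory.

Section CoordinateMap.
Variables (F : finFieldType) (vT : vectType F) (U : {vspace vT}).

(** Coordinates in a basis identify a row space with [U]. This transport is needed because
    [gauss_binom] counts subspaces of row spaces only. *)
Definition coord_comb (v : 'rV[F]_(\dim U)) : vT :=
  (\sum_i v ord0 i *: (vbasis U)`_i)%R.

Lemma coord_comb_is_linear : linear coord_comb.
Proof.
move=> a u v; rewrite /coord_comb scaler_sumr -big_split /=.
by apply: eq_bigr => i _; rewrite !mxE scalerDl scalerA.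
Qed.

HB.instance Definition _ :=
  GRing.isLinear.Build F 'rV[F]_(\dim U) vT *:%R coord_comb
    coord_comb_is_linear.

Lemma lker_coord_comb : lker (linfun coord_comb) == 0%VS.
Proof.
rewrite -subv0; apply/subvP => v; rewrite memv_ker lfunE /= memv0 => /eqP v0.
have /freeP fb := basis_free (vbasisP U).
by apply/eqP/rowP => i; rewrite mxE; apply: (fb (fun i => v ord0 i)).
Qed.

(** Combinations of basis vectors stay in [U], and the trivial kernel makes the dimensions agree. *)
Lemma limg_coord_comb : limg (linfun coord_comb) = U.
Proof.
apply/eqP; rewrite eqEdim; apply/andP; split.
  apply/subvP => _ /memv_imgP[v _ ->]; rewrite lfunE /=.
  apply: memv_suml => i _; apply: memvZ; apply: vbasis_mem.
  by rewrite mem_nth ?size_tuple.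
rewrite limg_dim_eq; first by rewrite dimvf /dim /= mul1n.
by rewrite (eqP lker_coord_comb) capv0.
Qed.

(** Taking images under the coordinate isomorphism is injective on subspaces, preserves dimension,
    and reaches exactly the subspaces of [U]. *)
Lemma card_subspaces_dim (t : nat) :
  #|[set T : {vspace vT} | (\dim T == t) && (T <= U)%VS]|
    = gauss_binom F (\dim U) t.
Proof.
pose f := linfun coord_comb; have kf := lker_coord_comb.
have dim_f (W : {vspace 'rV[F]_(\dim U)}) : \dim (f @: W) = \dim W.
  by apply: limg_dim_eq; rewrite (eqP kf) capv0.
have f_inj : injective (fun W : {vspace 'rV[F]_(\dim U)} => (f @: W)%VS).
  by move=> W1 W2 /= /eqP; rewrite eq_limg_ker0 // => /eqP.
rewrite /gauss_binom -(card_imset _ f_inj).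
congr #|pred_of_set _|; apply/setP => T; rewrite !inE.
apply/andP/imsetP => [[/eqP dT TU]|[W]]; last first.
  rewrite inE => /eqP dW ->; rewrite dim_f dW.
  by rewrite -[X in (_ <= X)%VS]limg_coord_comb limgS ?subvf.
(* The preimage of [T] is the required witness: [T] lies in [U], the image of [f], so mapping the
   preimage forward recovers [T]. *)
have fK : (f @: (f @^-1: T))%VS = T.
  by apply: lpreimK; rewrite limg_coord_comb.
by exists (f @^-1: T)%VS; rewrite ?fK // inE -dT -dim_f fK.
Qed.

End CoordinateMap.

(** The first [t] vectors of a basis span such a subspace. Positivity is what later allows
    cancelling and dividing by [gauss_binom F k t]. *)
Lemma gauss_binom_gt0 (F : finFieldType) (k t : nat) :
  t <= k -> 0 < gauss_binom F k t.
Proof.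
move=> htk; pose X := vbasis {:'rV[F]_k}.
have sX : size X = k by rewrite size_tuple dimvf /dim /= mul1n.
apply/card_gt0P; exists <<take t X>>%VS; rewrite inE.
have /eqP -> : free (take t X).
  by apply: (@catl_free _ _ (drop t X)); rewrite cat_take_drop (basis_free (vbasisP _)).
by rewrite size_takel ?sX.
Qed.

Section DoubleCounting.
Variables (F : finFieldType) (n : nat).
Implicit Types (B : {set {vspace 'rV[F]_n}}) (T : {vspace 'rV[F]_n}).

Lemma sum_card_containing (t k : nat) B :
    {in B, forall U, \dim U = k} ->
  \sum_(T : {vspace 'rV[F]_n} | \dim T == t) #|containing B T|
    = #|B| * gauss_binom F k t.
Proof.
move=> dimB.
(* Each cardinality becomes a sum of indicators over all [U], so that the range no longer depends on
   [T] and the sums can be exchanged. *)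
under eq_bigr do rewrite -sum1_card big_mkcond /=.
rewrite exchange_big /= -sum_nat_const [RHS]big_mkcond /=.
apply: eq_bigr => U _; under eq_bigr do rewrite inE.
have [UB|_] /= := boolP (U \in B); last by rewrite big1.
rewrite -(dimB _ UB) -card_subspaces_dim -sum1_card -big_mkcondr /=.
by apply: eq_bigl => T; rewrite inE.
Qed.

Lemma card_design (t k lam : nat) B :
    subspace_design t k lam B ->
  #|B| * gauss_binom F k t = lam * gauss_binom F n t.
Proof.
case/andP=> /forall_inP dimB /forall_inP desB.
rewrite -sum_card_containing => [|U /dimB/eqP//].
rewrite (eq_bigr (fun=> lam)) => [|T /desB/eqP//].
by rewrite sum_nat_cond_const mulnC.
Qed.

Lemma card_packing (t k lam : nat) B :
    subspace_packing t k lam B ->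
  #|B| * gauss_binom F k t <= lam * gauss_binom F n t.
Proof.
case/andP=> /forall_inP dimB /forall_inP packB.
rewrite -sum_card_containing => [|U /dimB/eqP//].
by rewrite mulnC -sum_nat_cond_const leq_sum.
Qed.

Lemma design_packing (t k lam : nat) B :
  subspace_design t k lam B -> subspace_packing t k lam B.
Proof.
case/andP=> dimB /forall_inP desB; apply/andP; split=> //.
by apply/forall_inP => T /desB/eqP->.
Qed.

(** Each family contributes [lam] blocks through a given [t]-subspace, and disjointness makes these
    contributions add up. *)
Lemma design_bigcup (I : finType) (t k lam : nat)
    (D : I -> {set {vspace 'rV[F]_n}}) :
    (forall i, subspace_design t k lam (D i)) ->
    (forall i j, i != j -> [disjoint D i & D j]) ->
  subspace_design t k (lam * #|I|) (\bigcup_i D i).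
Proof.
move=> desD disD; apply/andP; split; apply/forall_inP.
  move=> U /bigcupP[i _ Ui].
  by have /andP[/forall_inP/(_ U Ui)] := desD i.
move=> T dT; have -> : containing (\bigcup_i D i) T = \bigcup_i containing (D i) T.
  apply/setP => U; rewrite inE; apply/andP/bigcupP.
    by case=> /bigcupP[i _ Ui] TU; exists i; rewrite // inE Ui.
  by case=> i _; rewrite inE => /andP[Ui TU]; split=> //; apply/bigcupP; exists i.
rewrite -sum1_card partition_disjoint_bigcup /= => [|i j ij].
  rewrite (eq_bigr (fun=> lam)) => [|i _]; first by rewrite sum_nat_const mulnC.
  rewrite sum1_card; apply/eqP.
  by have /andP[_ /forall_inP/(_ T dT)] := desD i.
apply: disjointW (disD _ _ ij); apply/subsetP => U; rewrite inE; by case/andP.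
Qed.

End DoubleCounting.

Theorem theorem31 (F : finFieldType) (t k n lam s : nat)
    (ht : (1 <= t)%N) (htk : (t <= k)%N) (hkn : (k <= n)%N)
    (hlam : (1 <= lam)%N) (hs : (1 <= s)%N)
    (hD : exists D : 'I_s -> {set {vspace 'rV[F]_n}},
        (forall i, subspace_design t k lam (D i)) /\
        (forall i i', i != i' -> [disjoint D i & D i'])) :
  forall j : nat, (1 <= j <= s)%N ->
    ((max_packing F n k t (lam * j)%N)%:R : rat) =
    ((lam * j)%:R * (gauss_binom F n t)%:R / (gauss_binom F k t)%:R)%R.
Proof.
move=> j /andP[_ js]; have [D [desD disD]] := hD.
have g0 := gauss_binom_gt0 F htk.
pose B := \bigcup_(i < j) D (widen_ord js i).
have desB : subspace_design t k (lam * j) B.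
  (* Here [j] is read as the size of ['I_j]; [widen_ord] keeps the underlying number, so distinct
     indices stay distinct. *)
  by rewrite -[X in lam * X]card_ord; apply: design_bigcup => // i i' ii'; apply: disD.
have cB := card_design desB.
suff -> : max_packing F n k t (lam * j) = #|B|.
  by rewrite -natrM -cB natrM mulfK // pnatr_eq0 -lt0n.
apply/eqP; rewrite eqn_leq; apply/andP; split.
  (* The packing bound for [C] has the value that [B] attains as a design; the positive factor
     [gauss_binom F k t] then cancels. *)
  apply/bigmax_leqP => C /card_packing.
  by rewrite -cB leq_pmul2r.
exact: leq_bigmax_cond (design_packing desB).
Qed.
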